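(* Let $1\le p<\infty$ and let $d_{w,p}$ be a Lorentz sequence space with unit vector basis $(e_n)$. An operator $T\in L(d_{w,p})$ is $d_{w,p}$-strictly singular if and only if $\|Te_n\|\to 0$.
   Context: Let $1\le p<\infty$ and let $w=(w_n)$ be a real sequence with $w_1=1$, $w_n\downarrow 0$ and $\sum_n w_n=\infty$. The Lorentz sequence space $d_{w,p}$ is the Banach space of all $x=(x_n)\in c_0$ with $\|x\|_{d_{w,p}}=\big(\sum_{n}w_n (x^*_n)^p\big)^{1/p}<\infty$, where $(x^*_n)$ is the non-increasing rearrangement of $(|x_n|)$; $e_n$ is the sequence with $1$ in position $n$ and $0$ elsewhere. An operator $T\in L(d_{w,p})$ is $d_{w,p}$-strictly singular if for every closed subspace $Z\subseteq d_{w,p}$ isomorphic to $d_{w,p}$, the restriction $T|_Z$ is not an isomorphism. *)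

(* Defs.v *)
From HB Require Import structures.
From mathcomp Require Import all_boot all_order all_algebra.
From mathcomp Require Import all_classical all_reals all_analysis.
Set Implicit Arguments. Unset Strict Implicit. Unset Printing Implicit Defensive.
Import Order.TTheory GRing.Theory Num.Theory.
Import numFieldNormedType.Exports.
Local Open Scope classical_set_scope.
Local Open Scope ring_scope.

Definition rseq (R : realType) := nat -> R.

(* Non-increasing rearrangement of (|x_k|), 0-indexed:
   x^*_n = sup over (n+1)-element index sets A of min_{k in A} |x_k|.
   For x in c0 this is exactly the n-th term (from 0) of the
   non-increasing rearrangement of (|x_k|). *)
Definition rearr (R : realType) (x : rseq R) (n : nat) : R :=
  sup [set t : R | exists f : 'I_n.+1 -> nat,
         injective f /\ forall i, t <= `|x (f i)|].

Definition lorentz_psum (R : realType) (w : rseq R) (p : R) (x : rseq R)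
  (N : nat) : R :=
  \sum_(n < N) w n * (rearr x n) `^ p.

Definition in_dwp (R : realType) (w : rseq R) (p : R) (x : rseq R) : Prop :=
  x @ \oo --> (0 : R) /\ cvgn (lorentz_psum w p x).

Definition dwp_norm (R : realType) (w : rseq R) (p : R) (x : rseq R) : R :=
  (limn (lorentz_psum w p x)) `^ (p^-1).

(* Standing assumptions on the weight: w_1 = 1, w_n decreasing to 0,
   sum w_n = oo (indices shifted to start at 0). *)
Definition lorentz_weight (R : realType) (w : rseq R) : Prop :=
  [/\ w 0%N = 1,
      (forall n, w n.+1 <= w n),
      w @ \oo --> (0 : R)
    & ~ cvgn (fun N => \sum_(n < N) w n)].

Definition unitv (R : realType) (n : nat) : rseq R :=
  fun k => if k == n then 1 else 0.

Definition lincomb (R : realType) (a : R) (x y : rseq R) : rseq R :=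
  fun k => a * x k + y k.

Definition linear_on_dwp (R : realType) (w : rseq R) (p : R)
  (T : rseq R -> rseq R) : Prop :=
  forall a x y, in_dwp w p x -> in_dwp w p y ->
    T (lincomb a x y) = lincomb a (T x) (T y).

Definition bounded_op (R : realType) (w : rseq R) (p : R)
  (T : rseq R -> rseq R) : Prop :=
  [/\ linear_on_dwp w p T,
      (forall x, in_dwp w p x -> in_dwp w p (T x))
    & exists C : R, forall x, in_dwp w p x ->
        dwp_norm w p (T x) <= C * dwp_norm w p x].

Definition closed_subspace (R : realType) (w : rseq R) (p : R)
  (Z : set (rseq R)) : Prop :=
  [/\ (forall z, Z z -> in_dwp w p z),
      Z (fun _ => 0),
      (forall a z1 z2, Z z1 -> Z z2 -> Z (lincomb a z1 z2))
    & (forall (z : nat -> rseq R) (y : rseq R),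
        (forall k, Z (z k)) -> in_dwp w p y ->
        (fun k => dwp_norm w p (lincomb (-1) y (z k))) @ \oo --> (0 : R) ->
        Z y)].

Definition iso_to_dwp (R : realType) (w : rseq R) (p : R)
  (Z : set (rseq R)) : Prop :=
  exists S : rseq R -> rseq R,
    [/\ linear_on_dwp w p S,
        (forall x, in_dwp w p x -> Z (S x)),
        (forall z, Z z -> exists x, in_dwp w p x /\ S x = z)
      & exists c C : R, 0 < c /\
          forall x, in_dwp w p x ->
            c * dwp_norm w p x <= dwp_norm w p (S x) /\
            dwp_norm w p (S x) <= C * dwp_norm w p x].

Definition iso_on (R : realType) (w : rseq R) (p : R)
  (T : rseq R -> rseq R) (Z : set (rseq R)) : Prop :=
  exists c : R, 0 < c /\
    forall z, Z z -> c * dwp_norm w p z <= dwp_norm w p (T z).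

Definition dwp_strictly_singular (R : realType) (w : rseq R) (p : R)
  (T : rseq R -> rseq R) : Prop :=
  forall Z : set (rseq R), closed_subspace w p Z -> iso_to_dwp w p Z ->
    ~ iso_on w p T Z.

(* Main.v *)
(** Idea. Write [normp x] for the p-th power of the norm; it is the supremum of
    [sum_(r,i) w_r |x_i|^p] over the finite partial assignments of distinct weights
    [w_r] to distinct coordinates [i]. Images of unit vectors cannot be spread too thin:
    if pieces v_n of S e_n (S bounded) had norm^p at least d and sup norm tending to 0,
    then N of them could be given disjoint coordinates and weights, and a suitable choice
    of signs (convexity of t^p) would give a signed sum of N unit vectors whose image has
    norm^p at least N d / 2; but that signed sum has norm^p at most w_1 + ... + w_N = o(N).

    If T e_n does not tend to 0, infinitely many T e_n therefore have a coordinate of size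
    > t; since T e_n tends to 0 coordinatewise, a gliding hump gives n_k, m_k for which
    the matrix (T e_(n_j))(m_k) is almost diagonal, so T is bounded below on the closed
    span of the e_(n_k), an isometric copy of the whole space.

    Conversely let T e_n tend to 0 and suppose T S is bounded below for an isomorphic
    embedding S. Cut S e_n at height t: the large part has boundedly many coordinates,
    moving off to infinity, so T sends it to 0, while the small part is small in norm by
    the first paragraph once t is small. Hence T S e_n gets arbitrarily small, which is
    absurd. *)
Require Import Defs.
From HB Require Import structures.
From mathcomp Require Import all_boot all_order all_algebra.
From mathcomp Require Import all_classical all_reals all_analysis.
From mathcomp Require Import ring lra zify.
Import Order.TTheory GRing.Theory Num.Theory.
Import numFieldNormedType.Exports.
Local Open Scope classical_set_scope.
Local Open Scope ring_scope.

(** * Finite sums over duplicate-free lists *)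

Lemma leq_max_mem (I : eqType) (f : I -> nat) (s : seq I) i :
  i \in s -> (f i <= \max_(j <- s) f j)%N.
Proof. by move=> si; exact: leq_bigmax_seq. Qed.

Section Sums.
Context (R : realType).

Lemma ler_sum_exchange (I : eqType) (f : I -> R) (a b : seq I) :
  (size a <= size b)%N -> (forall i, 0 <= f i) ->
  {in a & b, forall i j, f i <= f j} ->
  \sum_(i <- a) f i <= \sum_(i <- b) f i.
Proof.
move=> sab f0; elim: a b sab => [|i a IH] [|j b] //= sab fab.
- by rewrite big_nil sumr_ge0.
rewrite !big_cons lerD ?fab ?mem_head// IH// => x y xa yb.
by apply: fab; rewrite inE ?xa ?yb orbT.
Qed.

Lemma sum_mem_split (I : eqType) (f : I -> R) (c d : seq I) :
  \sum_(i <- c) f i = \sum_(i <- [seq i <- c | i \in d]) f i +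
    \sum_(i <- [seq i <- c | i \notin d]) f i.
Proof. by rewrite !big_filter (bigID (mem d)). Qed.

(** Cancel the common indices: what is left of [a] lies outside [b], so it is dominated term by term
    by what is left of [b], which is at least as long. *)
Lemma ler_sum_uniq (I : eqType) (f : I -> R) (a b : seq I) :
  uniq a -> uniq b -> (size a <= size b)%N -> (forall i, 0 <= f i) ->
  (forall i j, i \notin b -> j \in b -> f i <= f j) ->
  \sum_(i <- a) f i <= \sum_(i <- b) f i.
Proof.
move=> ua ub sab f0 fab.
rewrite (sum_mem_split _ f a b) (sum_mem_split _ f b a).
have pab : perm_eq [seq i <- a | i \in b] [seq i <- b | i \in a].
  by apply: uniq_perm; rewrite ?filter_uniq// => i; rewrite !mem_filter andbC.
rewrite (perm_big _ pab)/= lerD2l ler_sum_exchange//.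
- move: sab; rewrite !size_filter -(count_predC (mem b) a) -(count_predC (mem a) b).
  by rewrite -!size_filter (perm_size pab) leq_add2l.
- by move=> i j; rewrite !mem_filter => /andP[ib _] /andP[_ jb]; apply: fab.
Qed.

Lemma ler_sum_sub (I : eqType) (f : I -> R) (a b : seq I) :
  uniq a -> uniq b -> (forall i, 0 <= f i) -> {subset a <= b} ->
  \sum_(i <- a) f i <= \sum_(i <- b) f i.
Proof.
move=> ua ub f0 ab; rewrite (sum_mem_split _ f b a).
have pab : perm_eq a [seq i <- b | i \in a].
  apply: uniq_perm; rewrite ?filter_uniq// => i; rewrite mem_filter.
  by case: (boolP (i \in a)) => // /ab.
by rewrite (perm_big _ pab) lerDl sumr_ge0.
Qed.

Lemma ler_sum_size (I : eqType) (f : I -> R) (c : R) (a : seq I) (n : nat) :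
  (size a <= n)%N -> 0 <= c -> {in a, forall i, f i <= c} ->
  \sum_(i <- a) f i <= n%:R * c.
Proof.
move=> an c0 fc; apply: (@le_trans _ _ ((size a)%:R * c)); last first.
  by rewrite ler_wpM2r// ler_nat.
elim: a fc {an} => [|i a IH] fc; first by rewrite big_nil mul0r.
rewrite big_cons/= -natr1 mulrDl mul1r addrC lerD ?fc ?mem_head// IH//.
by move=> j ja; apply: fc; rewrite inE ja orbT.
Qed.

Lemma sum_geo_uniq (l : seq nat) : uniq l -> \sum_(k <- l) 2^-1 ^+ k <= 2 :> R.
Proof.
move=> ul; have h0 k : 0 <= 2^-1 ^+ k :> R by rewrite exprn_ge0// invr_ge0.
pose N := (\max_(k <- l) k).+1.
apply: (@le_trans _ _ (\sum_(k <- index_iota 0 N) 2^-1 ^+ k)).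
  apply: ler_sum_sub; rewrite ?iota_uniq// => k kl.
  by rewrite mem_index_iota/= ltnS (leq_max_mem _ id).
suff -> : \sum_(k <- index_iota 0 N) 2^-1 ^+ k = 2 - 2^-1 ^+ N * 2 :> R.
  by rewrite gerBl mulr_ge0.
elim: N => [|N IH]; first by rewrite big_geq// expr0 mul1r subrr.
by rewrite big_nat_recr//= IH exprS; field.
Qed.

Lemma cvgr0_eventually (x : nat -> R) :
  x @ \oo --> (0 : R) <->
  forall e, 0 < e -> exists M, forall i, (M <= i)%N -> `|x i| <= e.
Proof.
split=> [xc e e0|h].
  by have [M _ hM] := cvgr0_norm_le _ xc _ e0; exists M => i Mi; exact: hM.
apply/cvgr0Pnorm_le => e /h[M hM]; exists M => // i Mi; exact: hM.
Qed.

End Sums.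

(** * The norm as a supremum over partial assignments of weights *)

Section Lorentz.
Context (R : realType) (p : R) (w : rseq R).
Hypotheses (hp : 1 <= p) (hw : lorentz_weight w).

Lemma p_gt0 : 0 < p. Proof. exact: lt_le_trans ltr01 hp. Qed.
Let p_ge0 : 0 <= p := ltW p_gt0.

Lemma weight_antitone : {homo w : m n / (m <= n)%N >-> n <= m}.
Proof. by case: hw => _ w1 _ _; apply/nonincreasing_seqP. Qed.

Lemma weight_ge0 n : 0 <= w n.
Proof.
case: hw => _ _ w0 _; rewrite -(cvg_lim _ w0)//.
by apply: nonincreasing_cvgn_ge; [exact: weight_antitone|apply/cvg_ex; exists 0].
Qed.

Lemma weight_le1 n : w n <= 1.
Proof. by case: hw => <- _ _ _; exact: weight_antitone. Qed.

Lemma weight_small e : 0 < e -> exists K, forall k, (K <= k)%N -> w k <= e.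
Proof.
case: hw => _ _ /cvgr0_eventually wc _ /wc[K hK]; exists K => k /hK.
by rewrite ger0_norm// weight_ge0.
Qed.

Lemma weight_unbounded B : exists N, B < \sum_(n < N) w n.
Proof.
case: hw => _ _ _ nc; apply: contrapT => /forallNP h; apply: nc.
apply: nondecreasing_is_cvgn.
  by apply/nondecreasing_seqP => n; rewrite big_ord_recr/= lerDl weight_ge0.
by exists B => _ [N _ <-]; rewrite leNgt; apply/negP/h.
Qed.

(* [s] lists pairs (weight index, coordinate); distinctness makes it a partial
   assignment of weights to coordinates. *)
Definition assignment (s : seq (nat * nat)) :=
  uniq [seq q.1 | q <- s] && uniq [seq q.2 | q <- s].

Definition asum (s : seq (nat * nat)) (x : rseq R) : R :=
  \sum_(q <- s) w q.1 * `|x q.2| `^ p.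

Definition vanishing (x : rseq R) := x @ \oo --> (0 : R).

(** If some entry outside [c] is nonzero, only finitely many entries exceed half of its modulus, so
    a maximum over a finite range suffices. If all are zero, any index outside [c] will do. *)
Lemma vanishing_argmax x (c : seq nat) : vanishing x ->
  exists2 i, i \notin c & forall j, j \notin c -> `|x j| <= `|x i|.
Proof.
move=> /cvgr0_eventually xc.
have [[j jc xj]|h] := pselect (exists2 j, j \notin c & 0 < `|x j|); last first.
  exists (\max_(k <- c) k).+1.
    by apply/negP => /(leq_max_mem _ id); rewrite ltnn.
  move=> j jc; apply: le_trans (normr_ge0 _); rewrite leNgt; apply/negP => xj.
  by apply: h; exists j.
have xj2 : 0 < `|x j| / 2 by rewrite divr_gt0.
have [M hM] := xc _ xj2.
have jM : (j < M)%N.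
  by rewrite ltnNge; apply/negP => /hM; rewrite leNgt ltr_pdivrMr// ltr_pMr// ltr1n.
pose P (i : 'I_M) := val i \notin c.
case: (@arg_maxP _ R 'I_M (Ordinal jM) P (fun i => `|x i|)) => //= i ic imax.
exists (val i) => // k kc; have [kM|Mk] := ltnP k M.
  exact: (imax (Ordinal kM)).
apply: le_trans (imax (Ordinal jM) jc); apply: le_trans (hM _ Mk) _.
by rewrite ler_pdivrMr// ler_peMr// ler1n.
Qed.

(** An initial piece of an ordering of the coordinates by decreasing modulus: each entry of [c] is
    maximal among the coordinates not listed before it. *)
Definition greedy (x : rseq R) (c : seq nat) := uniq c /\
  forall k, (k < size c)%N ->
    forall j, j \notin take k c -> `|x j| <= `|x (nth 0%N c k)|.

Lemma greedy_exists x N : vanishing x -> exists2 c, size c = N & greedy x c.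
Proof.
move=> xc; elim: N => [|N [c sc [uc hc]]]; first by exists [::].
have [i ic hi] := vanishing_argmax _ c xc.
exists (rcons c i); first by rewrite size_rcons sc.
split; first by rewrite rcons_uniq ic.
move=> k; rewrite size_rcons ltnS leq_eqVlt => /predU1P[->|kc] j.
  by rewrite -cats1 take_size_cat// nth_cat ltnn subnn/=; exact: hi.
by rewrite nth_rcons kc -cats1 take_cat kc; exact: hc.
Qed.

(** The first [k.+1] entries of [c] attain the supremum. Conversely, by pigeonhole, any [k.+1]
    distinct coordinates include one outside the first [k] entries, where the modulus is at most
    that of entry [k]. *)
Lemma greedy_rearr x c k : greedy x c -> (k < size c)%N ->
  rearr x k = `|x (nth 0%N c k)|.
Proof.
move=> [uc hc] kc.
rewrite /rearr; set E := (X in sup X).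
have Emax : E `|x (nth 0%N c k)|.
  exists (fun i : 'I_k.+1 => nth 0%N c i); split.
    move=> i j /eqP; rewrite nth_uniq ?(leq_trans (ltn_ord _) kc)// => /eqP.
    exact: val_inj.
  move=> i; apply: hc; first exact: (leq_trans (ltn_ord _) kc).
  apply/negP => /(nthP 0%N)[j].
  rewrite size_take_min leq_min => /andP[ji jc]; rewrite nth_take// => /eqP.
  by rewrite nth_uniq// => /eqP jk; move: ji (ltn_ord i); rewrite jk => ki; rewrite ltnNge ki.
have Eub : ubound E `|x (nth 0%N c k)|.
  move=> t [f [finj ft]].
  have [[i ic]|h] := pselect (exists i, f i \notin take k c).
    by apply: le_trans (ft i) _; exact: hc.
  have u : uniq [seq f i | i <- enum 'I_k.+1].
    by rewrite map_inj_uniq ?enum_uniq.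
  have sub : {subset [seq f i | i <- enum 'I_k.+1] <= take k c}.
    by move=> j /mapP[i _ ->]; apply/negPn/negP => ic; apply: h; exists i.
  have := uniq_leq_size u sub.
  by rewrite size_map size_enum_ord size_takel ?ltnn// ltnW.
apply/eqP; rewrite eq_le; apply/andP; split.
  by apply: ge_sup => //; exists `|x (nth 0%N c k)|.
by apply: ub_le_sup => //; exists `|x (nth 0%N c k)|.
Qed.

(** Give weight [k] to the [k]-th greedy coordinate. *)
Lemma lorentz_psum_asum x N : vanishing x ->
  exists2 s, assignment s & [seq q.1 | q <- s] = iota 0 N /\
    lorentz_psum w p x N = asum s x.
Proof.
move=> /(greedy_exists _ N)[c sc gc].
exists [seq (k, nth 0%N c k) | k <- iota 0 N].
  rewrite /assignment -!map_comp/= map_id iota_uniq/=.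
  have -> : [seq ((fun q => q.2) \o (fun k => (k, nth 0%N c k))) i | i <- iota 0 N] = c.
    by rewrite -sc; exact: mkseq_nth.
  by case: gc.
split; first by rewrite -map_comp map_id.
rewrite /lorentz_psum /asum big_map/= -(big_mkord xpredT (fun k => w k * rearr x k `^ p)).
rewrite /index_iota subn0 big_seq [RHS]big_seq; apply: eq_bigr => k.
by rewrite mem_iota/= add0n => kN; rewrite (greedy_rearr _ _ _ gc) ?sc.
Qed.

Lemma size_lt_fst (s : seq (nat * nat)) m : assignment s ->
  (size [seq q <- s | (q.1 < m)%N] <= m)%N.
Proof.
move=> /andP[us _].
have u : uniq [seq q.1 | q <- [seq q <- s | (q.1 < m)%N]].
  by apply: subseq_uniq us; rewrite map_subseq// filter_subseq.
rewrite -(size_map (fun q => q.1)) -[leqRHS](size_iota 0).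
apply: uniq_leq_size u _ => r /mapP[q]; rewrite mem_filter => /andP[qm _] ->.
by rewrite mem_iota.
Qed.

Lemma top_sum_le x (l : seq nat) m : vanishing x -> uniq l -> (size l <= m)%N ->
  \sum_(i <- l) `|x i| `^ p <= \sum_(n < m) rearr x n `^ p.
Proof.
move=> xc ul lm; have [c sc gc] := greedy_exists _ m xc.
have -> : \sum_(n < m) rearr x n `^ p = \sum_(i <- c) `|x i| `^ p.
  rewrite (big_nth 0%N) big_mkord sc; apply: eq_bigr => i _.
  by rewrite (greedy_rearr _ _ _ gc)// sc.
have [uc hc] := gc; apply: ler_sum_uniq; rewrite ?sc// => i j ic.
move=> /(nthP 0%N)[k kc <-]; rewrite ge0_ler_powR ?nnegrE//.
by apply: hc => //; apply: contra ic; exact: mem_take.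
Qed.

(** Summation by parts: for every [m], the coordinates that receive the first [m] weights have a
    p-th power sum of at most that of the [m] largest entries, and the weights decrease. *)
Lemma asum_le_psum x s N : vanishing x -> assignment s ->
  asum [seq q <- s | (q.1 < N)%N] x <= lorentz_psum w p x N.
Proof.
move=> xc vs.
pose b (q : nat * nat) := `|x q.2| `^ p.
pose B m := \sum_(q <- s | (q.1 < m)%N) b q.
pose B' m := \sum_(n < m) rearr x n `^ p.
have BB' m : B m <= B' m.
  rewrite /B -big_filter -(big_map (fun q => q.2) xpredT (fun i => `|x i| `^ p)).
  apply: top_sum_le => //; last by rewrite size_map size_lt_fst.
  case/andP: vs => _; apply: subseq_uniq.
  by rewrite map_subseq// filter_subseq.
have split_lt m (f : nat * nat -> R) : \sum_(q <- s | (q.1 < m.+1)%N) f q =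
    \sum_(q <- s | (q.1 < m)%N) f q + \sum_(q <- s | q.1 == m) f q.
  rewrite (bigID (fun q => (q.1 < m)%N))/=; congr (_ + _); apply: eq_bigl => q;
  rewrite ltnS; lia.
rewrite /asum big_filter -subr_ge0.
(* The nonnegative left side is the boundary term of the summation by parts; keeping it makes the
   induction on [N] go through. *)
suff : w N * (B' N - B N) <= lorentz_psum w p x N - \sum_(q <- s | (q.1 < N)%N) w q.1 * b q.
  by apply: le_trans; rewrite mulr_ge0 ?weight_ge0// subr_ge0.
elim: N => [|N IH].
  by rewrite /B /B' /lorentz_psum !big_ord0 !big_pred0// subrr mulr0.
apply: (@le_trans _ _ (w N * (B' N.+1 - B N.+1))).
  by rewrite ler_wpM2r ?subr_ge0// weight_antitone.
rewrite /lorentz_psum big_ord_recr/= split_lt.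
have -> : \sum_(q <- s | q.1 == N) w q.1 * b q = w N * \sum_(q <- s | q.1 == N) b q.
  by rewrite mulr_sumr; apply: eq_bigr => q /eqP ->.
rewrite /B split_lt /B' big_ord_recr/=.
move: IH; rewrite /B /B' /lorentz_psum; lra.
Qed.

Definition normp (x : rseq R) : R := limn (lorentz_psum w p x).

Lemma lorentz_psum_nondecreasing x :
  {homo lorentz_psum w p x : m n / (m <= n)%N >-> m <= n}.
Proof.
apply/nondecreasing_seqP => n.
by rewrite /lorentz_psum big_ord_recr/= lerDl mulr_ge0 ?weight_ge0 ?powR_ge0.
Qed.

Lemma asum_le_normp x s : in_dwp w p x -> assignment s -> asum s x <= normp x.
Proof.
move=> [xc xcv] vs; pose N := (\max_(q <- s) q.1).+1.
have -> : s = [seq q <- s | (q.1 < N)%N].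
  apply/esym/all_filterP/allP => q qs; rewrite ltnS.
  exact: (leq_max_mem _ (fun q => q.1)).
apply: le_trans (asum_le_psum _ _ _ xc vs) _.
by apply: nondecreasing_cvgn_le; [exact: lorentz_psum_nondecreasing|].
Qed.

(** Every partial sum is itself the sum of an assignment. Together with [asum_le_normp] this makes
    [normp] the supremum of [asum] over assignments, the only description used from here on. *)
Lemma normp_le x B : vanishing x -> (forall s, assignment s -> asum s x <= B) ->
  in_dwp w p x /\ normp x <= B.
Proof.
move=> xc h.
have hN N : lorentz_psum w p x N <= B.
  by have [s vs [_ ->]] := lorentz_psum_asum _ N xc; exact: h.
have xcv : cvgn (lorentz_psum w p x).
  apply: nondecreasing_is_cvgn; first exact: lorentz_psum_nondecreasing.
  by exists B => _ [N _ <-].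
by split=> //; apply: limr_le => //; near=> N.
Unshelve. all: by end_near. Qed.

(** Knowing that exactly the first [K] weights are used makes it possible to append pairs with later
    weights, as in [normp_tail]. *)
Lemma normp_approx x e : in_dwp w p x -> 0 < e ->
  exists K s, [/\ assignment s, [seq q.1 | q <- s] = iota 0 K &
    normp x - e <= asum s x].
Proof.
move=> [xc xcv] e0.
have : lorentz_psum w p x @ \oo --> normp x by exact: xcv.
move=> /cvgrPdist_le/(_ e e0)[K _ /(_ K (leqnn _)) hK].
have [s vs [s1 sx]] := lorentz_psum_asum _ K xc.
exists K, s; split=> //; rewrite -sx.
by move: hK => /=; rewrite ler_norml => /andP[_]; rewrite !lerBlDr addrC.
Qed.

Lemma asum_ge0 s x : 0 <= asum s x.
Proof. by apply: sumr_ge0 => q _; rewrite mulr_ge0 ?weight_ge0 ?powR_ge0. Qed.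

Lemma normp_ge0 x : in_dwp w p x -> 0 <= normp x.
Proof. by move=> /(asum_le_normp _ [::])/(_ isT); apply: le_trans; exact: asum_ge0. Qed.

(** * Powers with exponent p and pointwise domination *)

Lemma ler_powRp a b : 0 <= a -> a <= b -> a `^ p <= b `^ p.
Proof.
by move=> a0 ab; rewrite ge0_ler_powR ?nnegrE//; exact: le_trans ab.
Qed.

Lemma powRpK a : 0 <= a -> (a `^ p^-1) `^ p = a.
Proof. by move=> a0; rewrite -powRrM mulVf ?gt_eqF ?p_gt0// powRr1. Qed.

Lemma powRpVK a : 0 <= a -> (a `^ p) `^ p^-1 = a.
Proof. by move=> a0; rewrite -powRrM mulfV ?gt_eqF ?p_gt0// powRr1. Qed.

(** The sum is at most twice the larger term. This crude bound replaces the triangle inequality of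
    the norm throughout. *)
Lemma powR_addp a b : 0 <= a -> 0 <= b ->
  (a + b) `^ p <= 2 `^ p * (a `^ p + b `^ p).
Proof.
move=> a0 b0; have [ab|/ltW ba] := leP a b.
  apply: (@le_trans _ _ ((2 * b) `^ p)).
    by apply: ler_powRp; [exact: addr_ge0|rewrite mulr_natl mulr2n lerD2r].
  by rewrite powRM// ler_wpM2l ?powR_ge0// lerDr powR_ge0.
apply: (@le_trans _ _ ((2 * a) `^ p)).
  by apply: ler_powRp; [exact: addr_ge0|rewrite mulr_natl mulr2n lerD2l].
by rewrite powRM// ler_wpM2l ?powR_ge0// lerDl powR_ge0.
Qed.

(** Here [a] is the midpoint of [a + b] and [a - b], and t^p is convex and increasing on t >= 0. *)
Lemma powR_midp (a b : R) : `|a| `^ p *+ 2 <= `|a + b| `^ p + `|a - b| `^ p.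
Proof.
have mid u v : 0 <= u -> 0 <= v ->
    (2^-1 * u + 2^-1 * v) `^ p <= 2^-1 * u `^ p + 2^-1 * v `^ p.
  move=> u0 v0; rewrite {2 4}(_ : 2^-1 = 1 - 2^-1 :> R); last by field.
  by apply: (convex_powR hp (Itv01 _ _)) => //=;
    rewrite ?inE/= ?in_itv/= ?u0 ?v0// ?invr_ge0// invf_le1 ?ler1n.
have h : `|a| <= 2^-1 * `|a + b| + 2^-1 * `|a - b|.
  rewrite -mulrDr mulrC ler_pdivlMr// mulr_natr mulr2n.
  have -> : `|a| + `|a| = `|(a + b) + (a - b)|.
    by rewrite addrACA subrr addr0 -mulr2n normrMn mulr2n.
  exact: ler_normD.
have := le_trans (ler_powRp _ _ (normr_ge0 _) h) (mid _ _ (normr_ge0 _) (normr_ge0 _)).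
by rewrite -mulrDr mulrC ler_pdivlMr// mulr_natr.
Qed.

Lemma asum_dom s x y : (forall i, `|x i| <= `|y i|) -> asum s x <= asum s y.
Proof.
by move=> xy; apply: ler_sum => q _; rewrite ler_wpM2l ?weight_ge0// ler_powRp.
Qed.

Lemma asum_dom2 s (x y z : rseq R) : (forall i, `|x i| <= `|y i| + `|z i|) ->
  asum s x <= 2 `^ p * (asum s y + asum s z).
Proof.
move=> xyz; rewrite /asum -big_split mulr_sumr; apply: ler_sum => q _ /=.
rewrite -mulrDr mulrCA ler_wpM2l ?weight_ge0//.
exact: le_trans (ler_powRp _ _ _ (xyz _)) (powR_addp _ _ _ _).
Qed.

Lemma asumZ s a x : asum s (fun i => a * x i) = `|a| `^ p * asum s x.
Proof.
rewrite /asum mulr_sumr; apply: eq_bigr => q _.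
by rewrite normrM powRM// mulrCA.
Qed.

Lemma normp_dom x y : in_dwp w p y -> (forall i, `|x i| <= `|y i|) ->
  in_dwp w p x /\ normp x <= normp y.
Proof.
move=> yd xy; apply: normp_le.
  case: yd => /cvgr0_eventually yc _; apply/cvgr0_eventually => e /yc[M hM].
  by exists M => i /hM; exact: le_trans.
by move=> s vs; apply: le_trans (asum_dom _ _ _ xy) _; exact: asum_le_normp.
Qed.

Lemma normp_lincomb a x y : in_dwp w p x -> in_dwp w p y ->
  in_dwp w p (lincomb a x y) /\
  normp (lincomb a x y) <= 2 `^ p * (`|a| `^ p * normp x + normp y).
Proof.
move=> xd yd; apply: normp_le.
  case: xd yd => xc _ [yc _]; rewrite /vanishing -(addr0 0) -{1}(mulr0 a).
  by apply: cvgD => //; apply: cvgMr.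
move=> s vs.
apply: le_trans (asum_dom2 s _ (fun i => a * x i) y _) _ => [i|].
  exact: ler_normD.
rewrite ler_wpM2l ?powR_ge0// asumZ lerD ?asum_le_normp//.
by rewrite ler_wpM2l ?powR_ge0// asum_le_normp.
Qed.

Lemma coord_le_normp x i : in_dwp w p x -> `|x i| `^ p <= normp x.
Proof.
move=> xd; have := asum_le_normp _ [:: (0%N, i)] xd isT.
by rewrite /asum big_seq1/=; case: hw => -> _ _ _; rewrite mul1r.
Qed.

Lemma dwp_normK x : in_dwp w p x -> dwp_norm w p x `^ p = normp x.
Proof. by move=> xd; rewrite /dwp_norm powRpK// normp_ge0. Qed.

Lemma dwp_normE x : dwp_norm w p x = normp x `^ p^-1. Proof. by []. Qed.

Lemma dwp_norm_ge0 x : 0 <= dwp_norm w p x.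
Proof. exact: powR_ge0. Qed.

Lemma coord_le_norm x i : in_dwp w p x -> `|x i| <= dwp_norm w p x.
Proof.
move=> xd; rewrite -[leLHS]powRpVK// /dwp_norm ge0_ler_powR ?nnegrE ?powR_ge0//.
- by rewrite invr_ge0.
- exact: normp_ge0.
- exact: coord_le_normp.
Qed.

Lemma normp_le_of_norm x y C : in_dwp w p x -> in_dwp w p y -> 0 <= C ->
  dwp_norm w p x <= C * dwp_norm w p y -> normp x <= C `^ p * normp y.
Proof.
move=> xd yd C0 h.
by rewrite -dwp_normK// -(dwp_normK y)// -powRM ?dwp_norm_ge0// ler_powRp ?dwp_norm_ge0.
Qed.

Lemma norm_le_of_normp x y C : in_dwp w p x -> in_dwp w p y -> 0 <= C ->
  normp x <= C `^ p * normp y -> dwp_norm w p x <= C * dwp_norm w p y.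
Proof.
move=> xd yd C0 h.
rewrite /dwp_norm -{1}(powRpVK C)// -powRM ?powR_ge0 ?normp_ge0//.
rewrite ge0_ler_powR ?nnegrE ?invr_ge0// ?normp_ge0//.
by rewrite mulr_ge0 ?powR_ge0 ?normp_ge0.
Qed.

Lemma dwp_norm_cvg0 (u : nat -> rseq R) : (forall n, in_dwp w p (u n)) ->
  (fun n => dwp_norm w p (u n)) @ \oo --> (0 : R) <->
  forall e, 0 < e -> exists M, forall n, (M <= n)%N -> normp (u n) <= e.
Proof.
move=> ud; split=> [/cvgr0_eventually h e e0|h].
  have [M hM] := h (e `^ p^-1) (powR_gt0 _ e0); exists M => n /hM.
  rewrite ger0_norm ?dwp_norm_ge0// => hn.
  rewrite -(dwp_normK _ (ud n)) -[leRHS](powRpK _ (ltW e0)).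
  exact: ler_powRp (dwp_norm_ge0 _) hn.
apply/cvgr0_eventually => e e0.
have [M hM] := h (e `^ p) (powR_gt0 _ e0); exists M => n /hM hn.
rewrite (ger0_norm (dwp_norm_ge0 _)) -[leRHS](powRpVK _ (ltW e0)) dwp_normE.
apply: ge0_ler_powR; rewrite ?nnegrE ?invr_ge0 ?powR_ge0//.
by rewrite normp_ge0.
Qed.

Lemma small_powRp K c : 0 < c -> exists2 t, 0 < t & K%:R * t `^ p <= c.
Proof.
move=> c0; have d0 : 0 < c / K.+1%:R by rewrite divr_gt0.
exists ((c / K.+1%:R) `^ p^-1); first exact: powR_gt0.
rewrite powRpK ?(ltW d0)// mulrCA ger_pMr// ler_pdivrMr// mul1r ler_nat//.
Qed.

(** * Finitely supported vectors, truncations and tails *)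

Lemma size_in_snd (s : seq (nat * nat)) (l : seq nat) : assignment s ->
  (size [seq q <- s | q.2 \in l] <= size l)%N.
Proof.
move=> /andP[_ us].
have u : uniq [seq q.2 | q <- [seq q <- s | q.2 \in l]].
  by apply: subseq_uniq us; rewrite map_subseq// filter_subseq.
rewrite -(size_map (fun q => q.2)); apply: uniq_leq_size u _ => r /mapP[q].
by rewrite mem_filter => /andP[qm _] ->.
Qed.

Lemma eventually0_vanishing (x : rseq R) N :
  (forall i, (N <= i)%N -> x i = 0) -> vanishing x.
Proof.
move=> h; apply/cvgr0_eventually => e e0; exists N => i /h ->.
by rewrite normr0 ltW.
Qed.

(** In an assignment the first [K] weights contribute at most 1 each, and any later weight
    contributes at most [w K], and only on a coordinate of [l]. *)
Lemma normp_flat (y : rseq R) (l : seq nat) : uniq l ->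
  (forall i, `|y i| <= 1) -> (forall i, i \notin l -> y i = 0) ->
  in_dwp w p y /\ forall K, normp y <= K%:R + (size l)%:R * w K.
Proof.
move=> ul y1 y0.
have yc : vanishing y.
  apply: (eventually0_vanishing _ (\max_(k <- l) k).+1) => i hi; apply: y0.
  by apply/negP => /(leq_max_mem _ id)/(leq_trans hi); rewrite ltnn.
have key K s : assignment s -> asum s y <= K%:R + (size l)%:R * w K.
  move=> vs; apply: (@le_trans _ _ (\sum_(q <- s) ((if (q.1 < K)%N then 1 else 0) +
      if q.2 \in l then w K else 0))).
    apply: ler_sum => q _; have t1 : `|y q.2| `^ p <= 1.
      by apply: (le_trans (ler_powRp _ 1 _ _)) => //; rewrite powR1.
    have [qK|Kq] := ltnP q.1 K.
      apply: (@le_trans _ _ 1); last first.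
        by rewrite lerDl; case: ifP => // _; exact: weight_ge0.
      by rewrite mulr_ile1 ?weight_ge0 ?powR_ge0 ?weight_le1.
    rewrite add0r; case: ifPn => [ql|/y0 ->]; last first.
      by rewrite normr0 powR0 ?mulr0// gt_eqF ?p_gt0.
    rewrite -[leRHS]mulr1 ler_pM ?weight_ge0 ?powR_ge0//.
    exact: weight_antitone.
  rewrite big_split/= lerD//; rewrite -big_mkcond -big_filter.
    by rewrite -[leRHS]mulr1 ler_sum_size// size_lt_fst.
  by rewrite ler_sum_size ?weight_ge0// size_in_snd.
have [yd _] := normp_le _ _ yc (key 0%N).
by split=> // K; have [] := normp_le _ _ yc (key K).
Qed.

Definition trunc M (x : rseq R) : rseq R := fun i => if (i < M)%N then x i else 0.
Definition tail M (x : rseq R) : rseq R := fun i => if (i < M)%N then 0 else x i.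

Lemma in_dwp_trunc M x : in_dwp w p x -> in_dwp w p (trunc M x).
Proof.
move=> xd; have [] // := normp_dom (trunc M x) x xd.
by move=> i; rewrite /trunc; case: ifP => // _; rewrite normr0.
Qed.

Lemma in_dwp_tail M x : in_dwp w p x -> in_dwp w p (tail M x).
Proof.
move=> xd; have [] // := normp_dom (tail M x) x xd.
by move=> i; rewrite /tail; case: ifP => // _; rewrite normr0.
Qed.

Lemma assignment_cat s1 s2 : assignment s1 -> assignment s2 ->
  (forall q q', q \in s1 -> q' \in s2 -> q.1 <> q'.1 /\ q.2 <> q'.2) ->
  assignment (s1 ++ s2).
Proof.
move=> /andP[u1 v1] /andP[u2 v2] h.
rewrite /assignment !map_cat !cat_uniq u1 u2 v1 v2 !andbT/=.
apply/andP; split; apply/hasPn => _ /mapP[q' q's ->]; apply/negP => /mapP[q qs].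
  by move/esym; case: (h _ _ qs q's).
by move/esym; case: (h _ _ qs q's).
Qed.

Lemma assignment_filter a s : assignment s -> assignment [seq q <- s | a q].
Proof.
move=> /andP[u v]; apply/andP; split; [apply: subseq_uniq u|apply: subseq_uniq v];
by rewrite map_subseq// filter_subseq.
Qed.

Lemma asum_cat s1 s2 x : asum (s1 ++ s2) x = asum s1 x + asum s2 x.
Proof. by rewrite /asum big_cat. Qed.

Lemma asum_small s n t x : (size s <= n)%N -> 0 <= t ->
  (forall i, `|x i| <= t) -> asum s x <= n%:R * t `^ p.
Proof.
move=> sn t0 xt; apply: ler_sum_size; rewrite ?powR_ge0// => q _.
rewrite -[leRHS]mul1r ler_pM ?weight_ge0 ?powR_ge0 ?weight_le1//.
exact: ler_powRp.
Qed.

(** Take an assignment [s0] that attains [normp x] up to e/2, with weights below [K] and coordinates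
    below [M]. In an assignment for the tail, pairs with weight index below [K] are few and see only
    small entries; the other pairs can be appended to [s0], so they add at most e/2. *)
Lemma normp_tail x e : in_dwp w p x -> 0 < e ->
  exists M, normp (tail M x) <= e.
Proof.
move=> xd e0; have e20 : 0 < e / 2 by rewrite divr_gt0.
have [K [s0 [vs0 s01 hs0]]] := normp_approx x _ xd e20.
have [t t0 ht] := small_powRp K _ e20.
have xc : vanishing x by case: xd.
move/cvgr0_eventually: (xc) => /(_ _ t0)[M0 hM0].
pose M := maxn M0 (\max_(q <- s0) q.2).+1.
exists M; have [tc _] := in_dwp_tail M _ xd.
have [] // := normp_le (tail M x) e tc _ => s vs.
have -> : asum s (tail M x) = asum [seq q <- s | (q.1 < K)%N] (tail M x) +
   asum [seq q <- [seq q <- s | (M <= q.2)%N] | (K <= q.1)%N] x.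
  rewrite /asum !big_filter (bigID (fun q => (q.1 < K)%N))/=; congr (_ + _).
  rewrite big_mkcond [RHS]big_filter_cond [RHS]big_mkcond; apply: eq_bigr => q _ /=.
  rewrite -leqNgt /tail; case: (leqP K q.1); case: (ltnP q.2 M) => //= _ _.
  by rewrite normr0 powR0 ?mulr0// gt_eqF ?p_gt0.
rewrite (splitr e) lerD//.
  apply: le_trans ht; apply: asum_small; rewrite ?size_lt_fst// ?ltW// => i.
  rewrite /tail; case: ltnP => [_|Mi]; first by rewrite normr0 ltW.
  by apply: hM0; apply: leq_trans Mi; exact: leq_maxl.
rewrite -(lerD2l (asum s0 x)) -asum_cat; apply: (@le_trans _ _ (normp x)); last first.
  by rewrite -lerBlDr.
apply: asum_le_normp => //; apply: assignment_cat => //.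
  by do 2 apply: assignment_filter.
move=> q q' qs; rewrite !mem_filter => /and3P[Kq' Mq' _]; split=> E.
  have : q.1 \in iota 0 K by rewrite -s01 map_f.
  by rewrite mem_iota add0n E ltnNge Kq'.
have := leq_max_mem _ (fun q => q.2) _ _ qs.
by rewrite leqNgt => /negP; apply; rewrite E; apply: leq_trans Mq'; exact: leq_maxr.
Qed.

Local Opaque normp dwp_norm powR.
(** * Bounded operators on unit vectors *)

Lemma le_of_powRp a b : 0 <= a -> 0 <= b -> a `^ p <= b `^ p -> a <= b.
Proof.
move=> a0 b0; apply: contraTT; rewrite -!ltNge => ba.
by apply: gt0_ltr_powR; rewrite ?nnegrE// p_gt0.
Qed.

Lemma bounded_normp T : bounded_op w p T ->
  exists2 D, 0 < D & forall x, in_dwp w p x -> normp (T x) <= D * normp x.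
Proof.
move=> [_ Td [C hC]]; exists ((`|C| + 1) `^ p); first exact/powR_gt0/ltr_wpDl.
move=> x xd; apply: (normp_le_of_norm _ _ (`|C| + 1) (Td _ xd) xd).
  exact: addr_ge0.
apply: le_trans (hC _ xd) _; rewrite ler_wpM2r ?dwp_norm_ge0//.
by apply: le_trans (ler_norm _) _; rewrite lerDl.
Qed.

Lemma normp_unitv n : in_dwp w p (unitv R n) /\ normp (unitv R n) <= 1.
Proof.
have [i|i|ed /(_ 0%N)] := normp_flat (unitv R n) [:: n] isT.
- by rewrite /unitv; case: ifP => _; rewrite ?normr1 ?normr0.
- by rewrite inE /unitv => /negbTE ->.
move=> h; split=> //; move: h; rewrite add0r mul1r; case: hw => -> _ _ _; exact.
Qed.

Lemma in_dwp_unitv n : in_dwp w p (unitv R n).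
Proof. by case: (normp_unitv n). Qed.

Lemma normp0 : in_dwp w p (fun=> 0) /\ normp (fun=> 0) <= 0.
Proof.
apply: normp_le => [|s _]; first exact: (eventually0_vanishing _ 0%N).
rewrite /asum big1// => q _; rewrite normr0 powR0 ?mulr0//.
by rewrite gt_eqF ?p_gt0.
Qed.

Lemma bounded_op0 T : bounded_op w p T -> T (fun=> 0) = fun=> 0.
Proof.
move=> [Tl _ _]; have [d0 _] := normp0.
have {1}-> : (fun=> 0) = lincomb (-1) (fun=> 0) (fun=> 0) :> rseq R.
  by apply/funext => i; rewrite /lincomb mulr0 addr0.
by rewrite Tl//; apply/funext => i; rewrite /lincomb mulN1r addNr.
Qed.

(** [N] counts the unit vectors combined so far; the bound [M] on the support tells where the next
    one may be placed. *)
Definition flat (N M : nat) (y : rseq R) := exists2 l : seq nat,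
  [/\ uniq l, size l = N & all (fun i => i < M)%N l] &
  (forall i, `|y i| <= 1) /\ (forall i, i \notin l -> y i = 0).

Lemma flat0 : flat 0 0 (fun=> 0).
Proof. by exists [::]; split=> // i; rewrite normr0. Qed.

Lemma flat_step N M y n a : flat N M y -> (M <= n)%N -> `|a| <= 1 ->
  flat N.+1 n.+1 (lincomb a (unitv R n) y).
Proof.
move=> [l [ul sl al] [y1 y0]] Mn a1.
have nl : n \notin l by apply/negP => /(allP al); rewrite ltnNge Mn.
exists (n :: l).
  split; rewrite /= ?nl ?sl ?ltnS ?leqnn//=.
  by apply/allP => i /(allP al) iM; rewrite ltnS (leq_trans (ltnW iM)).
split=> i.
  rewrite /lincomb /unitv; case: eqVneq => [->|_]; last by rewrite mulr0 add0r.
  by rewrite y0// mulr1 addr0.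
rewrite inE negb_or => /andP[/negbTE ni /y0 yi].
by rewrite /lincomb /unitv ni yi mulr0 addr0.
Qed.

Lemma in_dwp_flat N M y : flat N M y -> in_dwp w p y.
Proof. by move=> [l [ul _ _] [y1 y0]]; have [] := normp_flat y l ul y1 y0. Qed.

(* The norm^p of N-term flat vectors is o(N), because [w] tends to 0. *)
Lemma flat_sublinear (c D : R) : 0 < c -> 0 < D ->
  (forall N, exists M y, flat N M y /\ N%:R * c <= D * normp y) -> False.
Proof.
move=> c0 D0 h.
have cD : 0 < c / (2 * D) by rewrite divr_gt0// mulr_gt0.
(* Beyond weight [K] the [N] coordinates account for at most half of [N%:R * c]; the first [K]
   weights give at most [D * K%:R], which the [N] below is chosen to beat. *)
have [K /(_ K (leqnn _)) wK] := weight_small _ cD.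
pose N := Num.bound (D * K%:R * 2 / c).
have [M [y [[l [ul sl _] [y1 y0]] yN]]] := h N.
have [_ /(_ K)] := normp_flat y l ul y1 y0.
rewrite sl => /(ler_wpM2l (ltW D0))/(le_trans yN).
rewrite mulrDr mulrCA => yN'.
have DwK : D * w K <= c / 2.
  apply: le_trans (ler_wpM2l (ltW D0) wK) _.
  by rewrite (_ : D * _ = c / 2)//; field; rewrite gt_eqF.
have : N%:R * (c / 2) <= D * K%:R.
  have := ler_wpM2l (ler0n R N) DwK; lra.
apply/negP; rewrite -ltNge mulrA ltr_pdivlMr// -ltr_pdivrMr//.
apply: archi_boundP; rewrite divr_ge0 ?mulr_ge0 ?(ltW D0) ?(ltW c0)//.
Qed.

Lemma sign_align (u v : R) : exists2 a : R, `|a| <= 1 & `|a * u + v| = `|u| + `|v|.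
Proof.
have [u0|u0] := leP 0 u; have [v0|v0] := leP 0 v.
- by exists 1; rewrite ?normr1// mul1r !ger0_norm// addr_ge0.
- exists (-1); rewrite ?normrN1// mulN1r (ger0_norm u0) (ltr0_norm v0).
  by rewrite ler0_norm ?opprD ?opprK//; lra.
- exists (-1); rewrite ?normrN1// mulN1r (ger0_norm v0) (ltr0_norm u0).
  by rewrite ger0_norm//; lra.
- exists 1; rewrite ?normr1// mul1r (ltr0_norm v0) (ltr0_norm u0).
  by rewrite ler0_norm ?opprD//; lra.
Qed.

(* If not, suitably signed sums of N unit vectors would have image of size at least N e
   at coordinate [m], while their norm^p is o(N). *)
Lemma coord_image_vanishing S m : bounded_op w p S ->
  forall e, 0 < e -> exists M, forall n, (M <= n)%N -> `|S (unitv R n) m| <= e.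
Proof.
move=> bS e e0; apply: contrapT => nh.
have hex M : exists2 n, (M <= n)%N & e < `|S (unitv R n) m|.
  apply: contrapT => h; apply: nh; exists M => n Mn.
  by rewrite leNgt; apply/negP => en; apply: h; exists n.
have [D D0 hD] := bounded_normp _ bS; have [Sl Sd _] := bS.
have sums N : exists M y, flat N M y /\ N%:R * e <= `|S y m|.
  elim: N => [|N [M [y [fy hy]]]].
    by exists 0%N, (fun=> 0); split; [exact: flat0|rewrite mul0r].
  have [n Mn en] := hex M; have [a a1 ha] := sign_align (S (unitv R n) m) (S y m).
  exists n.+1, (lincomb a (unitv R n) y); split; first exact: flat_step fy Mn a1.
  rewrite Sl; [|exact: in_dwp_unitv|exact: in_dwp_flat fy].
  by rewrite /lincomb ha -natr1 mulrDl mul1r addrC lerD// ltW.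
apply: (flat_sublinear (e `^ p) D) => // [|N]; first exact: powR_gt0.
have [M [y [fy hy]]] := sums N; exists M, y; split=> //.
have yd := in_dwp_flat _ _ _ fy.
apply: le_trans (hD _ yd); apply: le_trans (coord_le_normp _ m (Sd _ yd)).
apply: le_trans (ler_powRp _ _ _ hy); last by rewrite mulr_ge0// ltW.
(* It remains to see that N <= N^p, which follows from p >= 1 once N is nonzero. *)
rewrite powRM ?(ltW e0)// ler_wpM2r ?powR_ge0//.
case: N {hy fy} => [|N]; first exact: powR_ge0.
by rewrite -[leLHS]powRr1// ler_powR// ler1n.
Qed.

Lemma coords_image_vanishing S M : bounded_op w p S ->
  forall e, 0 < e -> exists N, forall n, (N <= n)%N ->
    forall i, (i < M)%N -> `|S (unitv R n) i| <= e.
Proof.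
move=> bS e e0; elim: M => [|M [N hN]]; first by exists 0%N.
have [N' hN'] := coord_image_vanishing _ M bS _ e0.
exists (maxn N N') => n; rewrite geq_max => /andP[Nn N'n] i.
by rewrite ltnS leq_eqVlt => /predU1P[->|]; [exact: hN'|exact: hN].
Qed.

(** Averaging over the sign loses neither summand. The two halves are meant for disjoint
    assignments, one tuned to [y] and one to [e], so that a single sign serves both. *)
Lemma asum_mid s (e y : rseq R) :
  asum s y *+ 2 <= asum s (lincomb 1 e y) + asum s (lincomb (-1) e y) /\
  asum s e *+ 2 <= asum s (lincomb 1 e y) + asum s (lincomb (-1) e y).
Proof.
split; rewrite /asum -big_split -sumrMnl; apply: ler_sum => q _ /=;
  rewrite -mulrDr -mulrnAr ler_wpM2l ?weight_ge0// /lincomb mul1r mulN1r.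
  by rewrite (addrC (e _)) (addrC (- e _)); exact: powR_midp.
by rewrite -(normrN (- e _ + _)) opprD opprK; exact: powR_midp.
Qed.

(* Otherwise one could stack such minorants, on disjoint sets of coordinates and
   weights, under a signed sum of N unit vectors: its image would have norm^p at
   least N d / 2, whereas the norm^p of the sum itself is o(N). *)
Lemma small_minorants S d : bounded_op w p S -> 0 < d ->
  exists t N, 0 < t /\ forall n (v : rseq R), (N <= n)%N ->
    (forall i, `|v i| <= `|S (unitv R n) i|) -> (forall i, `|v i| <= t) ->
    normp v <= d.
Proof.
move=> bS d0; apply: contrapT => nh.
have hex t N : 0 < t -> exists n (v : rseq R), [/\ (N <= n)%N,
    forall i, `|v i| <= `|S (unitv R n) i|, forall i, `|v i| <= t & d < normp v].
  move=> t0; apply: contrapT => h; apply: nh; exists t, N; split=> // n v Nn vS vt.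
  by rewrite leNgt; apply/negP => dv; apply: h; exists n, v.
have [D D0 hD] := bounded_normp _ bS; have [Sl Sd _] := bS.
apply: (flat_sublinear (d / 2) D) => //; first exact: divr_gt0.
suff stack N : exists M y s, [/\ flat N M y, assignment s & N%:R * (d / 2) <= asum s (S y)].
  move=> N; have [M [y [s [fy vs hs]]]] := stack N; exists M, y; split=> //.
  have yd := in_dwp_flat _ _ _ fy.
  exact: le_trans hs (le_trans (asum_le_normp _ _ (Sd _ yd) vs) (hD _ yd)).
elim: N => [|N [M [y [s [fy vs hs]]]]].
  by exists 0%N, (fun=> 0), [::]; split=> //; [exact: flat0|rewrite mul0r asum_ge0].
pose K := (\max_(q <- s) q.1).+1; pose c := [seq q.2 | q <- s].
have d4 : 0 < d / 4 by rewrite divr_gt0.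
(* At most [K + size c] pairs of a new assignment reuse an old weight or coordinate; with entries
   below this [t] they cost at most d/4. *)
have [t t0 ht] := small_powRp (K + size c)%N _ d4.
have [n [v [Mn vS vt dv]]] := hex t M t0.
have Sed := Sd _ (in_dwp_unitv n).
have [vd _] := normp_dom v _ Sed vS.
have [_ [s0 [vs0 _ hs0]]] := normp_approx _ _ vd d4.
pose a (q : nat * nat) := (K <= q.1)%N && (q.2 \notin c).
pose s1 := [seq q <- s0 | a q].
(* From [d], one quarter is lost by approximating [normp v] and one by dropping the pairs that are
   not fresh. *)
have hs1 : d / 2 <= asum s1 v.
  have : asum s0 v = asum s1 v + asum [seq q <- s0 | ~~ a q] v.
    by rewrite /asum !big_filter (bigID a).
  have : asum [seq q <- s0 | ~~ a q] v <= d / 4.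
    apply: le_trans ht; apply: asum_small => //; last exact: ltW.
    rewrite (@eq_filter _ _ (predU (fun q => (q.1 < K)%N) (fun q => q.2 \in c))); last first.
      by move=> q; rewrite /a/= negb_and negbK -ltnNge.
    rewrite size_filter -(leq_add2r (count (predI (fun q => (q.1 < K)%N) (fun q => q.2 \in c)) s0)).
    rewrite count_predUI (leq_trans _ (leq_addr _ _))//.
    by rewrite -!size_filter leq_add ?size_lt_fst ?size_in_snd.
  move: hs0 dv; lra.
have vs1 : assignment (s ++ s1).
  apply: assignment_cat => //; first exact: assignment_filter.
  move=> q q' qs; rewrite mem_filter => /andP[/andP[Kq' q'c] _]; split=> E.
    have := leq_max_mem _ (fun q => q.1) _ _ qs.
    by rewrite E leqNgt => /negP; apply.
  by move/negP: q'c; apply; rewrite -E map_f.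
have yd := in_dwp_flat _ _ _ fy.
suff [b b1 hb] : exists2 b, `|b| <= 1 &
    N.+1%:R * (d / 2) <= asum (s ++ s1) (lincomb b (S (unitv R n)) (S y)).
  exists n.+1, (lincomb b (unitv R n) y), (s ++ s1); split=> //.
    exact: flat_step fy Mn b1.
  by rewrite (Sl b _ _ (in_dwp_unitv n) yd).
(* The average over the two signs is at least [asum s (S y)] on [s] and at least [asum s1 v] on
   [s1]; hence one of the signs reaches the required total on [s ++ s1]. *)
have [m1 _] := asum_mid s (S (unitv R n)) (S y).
have [_ m2] := asum_mid s1 (S (unitv R n)) (S y).
have m3 := asum_dom s1 _ _ vS.
have [h|h] := leP (N.+1%:R * (d / 2)) (asum (s ++ s1) (lincomb 1 (S (unitv R n)) (S y))).
  by exists 1; rewrite ?normr1.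
exists (-1); first by rewrite normrN1.
move: h; rewrite !asum_cat -natr1; lra.
Qed.

(** * Images expanded along the unit vectors *)

Lemma trunc_image T x M m : bounded_op w p T -> in_dwp w p x ->
  T (trunc M x) m = \sum_(i < M) x i * T (unitv R i) m.
Proof.
move=> bT xd; have [Tl _ _] := bT; elim: M => [|M IH].
  rewrite big_ord0 (_ : trunc 0 x = fun=> 0) ?(bounded_op0 _ bT)//.
rewrite big_ord_recr/= -IH.
have -> : trunc M.+1 x = lincomb (x M) (unitv R M) (trunc M x).
  apply/funext => i; rewrite /trunc /lincomb /unitv ltnS leq_eqVlt.
  by case: eqVneq => [->|_]; rewrite ?ltnn ?mulr1 ?addr0// mulr0 add0r.
rewrite Tl; [|exact: in_dwp_unitv|exact: in_dwp_trunc].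
by rewrite /lincomb addrC.
Qed.

(** The difference is coordinate [m] of the image of a tail of [x]. Tails tend to 0 in norm and [T]
    is bounded. *)
Lemma coord_expansion T x m e : bounded_op w p T -> in_dwp w p x -> 0 < e ->
  exists M, forall M', (M <= M')%N ->
    `|T x m - \sum_(i < M') x i * T (unitv R i) m| <= e.
Proof.
move=> bT xd e0; have [D D0 hD] := bounded_normp _ bT; have [Tl Td _] := bT.
have ed : 0 < e `^ p / D by rewrite divr_gt0// powR_gt0.
have [M0 hM0] := normp_tail x _ xd ed; exists M0 => M M0M.
have td := in_dwp_tail M _ xd.
have hM : normp (tail M x) <= e `^ p / D.
  apply: le_trans hM0; apply: (normp_dom _ _ (in_dwp_tail M0 _ xd) _).2 => i.
  rewrite /tail; case: (ltnP i M) => Mi; first by rewrite normr0.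
  by rewrite ltnNge (leq_trans M0M Mi).
rewrite -(trunc_image _ _ _ _ bT xd).
have -> : T x m - T (trunc M x) m = T (tail M x) m.
  have {1}-> : x = lincomb 1 (tail M x) (trunc M x).
    apply/funext => i; rewrite /lincomb /tail /trunc mul1r.
    by case: ifP => _; rewrite ?add0r ?addr0.
  rewrite (Tl 1 _ _ td (in_dwp_trunc M _ xd)).
  by rewrite /lincomb mul1r addrK.
apply: le_of_powRp => //; first exact: ltW.
apply: le_trans (coord_le_normp _ _ (Td _ td)) _.
apply: le_trans (hD _ td) _.
by rewrite mulrC -ler_pdivlMr.
Qed.

Definition restrict (l : seq nat) (x : rseq R) : rseq R :=
  fun i => if i \in l then x i else 0.

Lemma quasi_const_ge1 : 1 <= 2 `^ p * 2 :> R.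
Proof.
rewrite -[leLHS]mul1r ler_pM//; last by rewrite ler1n.
have h : 1 <= 2 :> R by rewrite ler1n.
by have := @ler_powR R 2 h 0 p p_ge0; rewrite powRr0.
Qed.

(** Coordinates are added one at a time, each costing the factor of the quasi-triangle inequality.
    The exponential constant is harmless because [l] will have bounded length. *)
Lemma normp_image_restrict T z l e : bounded_op w p T -> in_dwp w p z ->
  uniq l -> 0 <= e -> {in l, forall i, `|z i| `^ p * normp (T (unitv R i)) <= e} ->
  normp (T (restrict l z)) <= (2 `^ p * 2) ^+ size l * e.
Proof.
move=> bT zd ul e0; have [Tl Td _] := bT.
have rd k : in_dwp w p (restrict k z).
  have [] // := normp_dom (restrict k z) z zd.
  by move=> i; rewrite /restrict; case: ifP => // _; rewrite normr0.
elim: l ul => [_ _|i l IH /= /andP[il ul] h].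
  rewrite (_ : restrict [::] z = fun=> 0)// bounded_op0//.
  by case: normp0 => _ /le_trans; apply; rewrite mul1r.
have -> : restrict (i :: l) z = lincomb (z i) (unitv R i) (restrict l z).
  apply/funext => j; rewrite /restrict /lincomb /unitv inE.
  by case: eqVneq => [->|_]; rewrite ?(negbTE il) ?mulr1 ?addr0// mulr0 add0r.
have ed := in_dwp_unitv i.
rewrite (Tl _ _ _ ed (rd l)); have [_] := normp_lincomb (z i) _ _ (Td _ ed) (Td _ (rd l)).
move=> /le_trans; apply; rewrite exprS -!mulrA ler_wpM2l ?powR_ge0//.
rewrite mulr_natl mulr2n lerD//; last first.
  by apply: IH => // j jl; apply: h; rewrite inE jl orbT.
apply: le_trans (h i (mem_head _ _)) _; rewrite ler_peMl// exprn_ege1//.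
exact: quasi_const_ge1.
Qed.

(** Here the divergence of the weight series enters: more than [N] such coordinates, given the first
    [N] weights, would already push the norm^p above [B]. *)
Lemma big_coords_count B t : 0 < t -> exists L, forall z l, in_dwp w p z ->
  normp z <= B -> uniq l -> {in l, forall i, t <= `|z i|} -> (size l <= L)%N.
Proof.
move=> t0; have tp : 0 < t `^ p by exact: powR_gt0.
have [N hN] := weight_unbounded (B / t `^ p).
exists N => z l zd zB ul zt; rewrite leqNgt; apply/negP => Nl.
pose s := [seq (k, nth 0%N l k) | k <- iota 0 N].
have vs : assignment s.
  rewrite /assignment -!map_comp/= map_id iota_uniq/=.
  rewrite (eq_map (g := nth 0%N l))// map_inj_in_uniq ?iota_uniq// => i j.
  rewrite !mem_iota !add0n/= => iN jN /eqP; rewrite nth_uniq ?(ltn_trans _ Nl)//.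
  by move/eqP.
have := le_trans (asum_le_normp _ _ zd vs) zB; apply/negP; rewrite -ltNge.
move: hN; rewrite ltr_pdivrMr// => /lt_le_trans; apply.
rewrite -(big_mkord xpredT) /index_iota subn0 mulr_suml /asum big_map.
rewrite big_seq [leRHS]big_seq ler_sum// => k; rewrite mem_iota add0n/= => kN.
rewrite ler_wpM2l ?weight_ge0// ler_powRp ?(ltW t0)//.
by apply: zt; rewrite mem_nth// (ltn_trans kN).
Qed.
(** * Vanishing images of the unit vectors force singularity *)

Lemma singular_of_image_cvg0 T : bounded_op w p T ->
  (forall e, 0 < e -> exists M, forall n, (M <= n)%N -> normp (T (unitv R n)) <= e) ->
  dwp_strictly_singular w p T.
Proof.
move=> bT hTe Z [Zd _ _ _] [S [Slin SZ _ [c1 [C [c10 hS]]]]] [c2 [c20 hTZ]].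
have bS : bounded_op w p S.
  split; [exact: Slin|by move=> x /SZ/Zd|exists C => x /hS[_]; exact].
have [D D0 hD] := bounded_normp _ bT; have [D' D'0 hD'] := bounded_normp _ bS.
have [Tl Td _] := bT; have [_ Sd _] := bS.
pose g := (c2 * c1) `^ p; have g0 : 0 < g by rewrite powR_gt0// mulr_gt0.
have low n : g <= normp (T (S (unitv R n))).
  have ed := in_dwp_unitv n; have [h _] := hS _ ed.
  rewrite /g -(dwp_normK _ (Td _ (Sd _ ed))).
  apply: ler_powRp; first exact: ltW (mulr_gt0 c20 c10).
  apply: le_trans (hTZ _ (SZ _ ed)); rewrite (ler_pM2l c20).
  apply: le_trans h; rewrite (ler_peMr (ltW c10))//.
  have := coord_le_norm _ n ed; by rewrite /unitv eqxx normr1.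
pose A : R := 2 `^ p; have A0 : 0 < A by exact: powR_gt0.
(* Two pieces of size [e1] combine to at most [A * (e1 + e1)], that is g/2, below the lower bound
   [g]. *)
pose e1 := g / (4 * A); have e10 : 0 < e1 by rewrite divr_gt0// mulr_gt0.
have [t [N [t0 hv]]] := small_minorants _ _ bS (divr_gt0 e10 D0).
have [L hL] := big_coords_count D' _ t0.
(* The denominator absorbs the constant of [normp_image_restrict] for at most [L] large
   coordinates. *)
pose e2 := e1 / (A * 2) ^+ L.
have AL0 : 0 < (A * 2) ^+ L by rewrite exprn_gt0// mulr_gt0.
have e20 : 0 < e2 by rewrite divr_gt0.
have [M hM] := hTe _ (divr_gt0 e20 D'0).
have t20 : 0 < t / 2 by rewrite divr_gt0.
(* Past [N'] the coordinates of S e_n below [M] are at most t/2 < t, so every coordinate of modulus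
   at least [t] lies where T e_i is already small. *)
have [N' hN'] := coords_image_vanishing _ M bS _ t20.
pose n := maxn N N'; pose z := S (unitv R n).
have zd : in_dwp w p z := Sd _ (in_dwp_unitv n).
have zD' : normp z <= D'.
  have [ed e1'] := normp_unitv n; apply: le_trans (hD' _ ed) _.
  by rewrite ger_pMr.
have [M' hM'] : exists M', forall i, (M' <= i)%N -> `|z i| <= t / 2.
  by have [/cvgr0_eventually zc _] := zd; exact: zc.
have t2t : t / 2 < t by rewrite ltr_pdivrMr// ltr_pMr// ltr1n.
pose l := [seq i <- iota 0 M' | t <= `|z i|].
have ul : uniq l by rewrite filter_uniq ?iota_uniq.
have lP i : (i \in l) = (t <= `|z i|).
  rewrite mem_filter mem_iota add0n/=; case: (leqP M' i) => [/hM' zi|_]; last by rewrite andbT.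
  by rewrite andbF; apply/esym/negbTE; rewrite -ltNge; exact: le_lt_trans t2t.
pose v : rseq R := fun i => if i \in l then 0 else z i.
have vz i : `|v i| <= `|z i| by rewrite /v; case: ifP => // _; rewrite normr0.
have vt i : `|v i| <= t.
  rewrite /v lP; case: (leP t `|z i|) => [_|/ltW//]; rewrite normr0; exact: ltW.
have [vd _] := normp_dom v z zd vz.
have vsmall : normp (T v) <= e1.
  apply: le_trans (hD _ vd) _; rewrite mulrC -ler_pdivlMr//.
  by apply: (hv n) => //; exact: leq_maxl.
have bsmall : normp (T (restrict l z)) <= e1.
  have h : {in l, forall i, `|z i| `^ p * normp (T (unitv R i)) <= e2}.
    move=> i; rewrite lP => ti; have Mi : (M <= i)%N.
      rewrite leqNgt; apply/negP => iM.
      have := hN' n (leq_maxr _ _) i iM; rewrite leNgt => /negP; apply.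
      exact: lt_le_trans ti.
    apply: (@le_trans _ _ (D' * (e2 / D'))); last by rewrite mulrC divfK// gt_eqF.
    rewrite ler_pM ?powR_ge0 ?hM//.
      by apply: normp_ge0; apply: Td; exact: in_dwp_unitv.
    exact: le_trans (coord_le_normp _ i zd) zD'.
  apply: le_trans (normp_image_restrict _ _ _ _ bT zd ul (ltW e20) h) _.
  rewrite /e2 mulrC mulrAC ler_pdivrMr// ler_pM2l//.
  apply: ler_weXn2l; last by apply: hL zd zD' ul _ => i; rewrite lP.
  exact: quasi_const_ge1.
have rd : in_dwp w p (restrict l z).
  have [] // := normp_dom (restrict l z) z zd.
  by move=> i; rewrite /restrict; case: ifP => // _; rewrite normr0.
have zE : z = lincomb 1 (restrict l z) v.
  apply/funext => i; rewrite /lincomb /restrict /v mul1r.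
  by case: ifP => _; rewrite ?addr0 ?add0r.
have := low n; rewrite -/z zE (Tl 1 _ _ rd vd); apply/negP; rewrite -ltNge.
have [_ /le_lt_trans] := normp_lincomb 1 _ _ (Td _ rd) (Td _ vd); apply.
rewrite normr1 (_ : 1 `^ p = 1) ?powR1// mul1r -/A.
apply: (@le_lt_trans _ _ (A * (e1 + e1))).
  exact: (ler_wpM2l (ltW A0) (lerD bsmall vsmall)).
rewrite (_ : A * (e1 + e1) = g / 2); last by rewrite /e1; field; rewrite gt_eqF.
by rewrite ltr_pdivrMr// ltr_pMr// ltr1n.
Qed.

(** * Copies of the space spanned by subsequences of the unit vectors *)

Section Spread.
Context (n k : nat -> nat).
Hypothesis nK : cancel n k.

(** The isometric embedding sending e_j to e_(n_j). Since [k] is a left inverse of [n], the test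
    [n (k i) == i] decides whether [i] is in the range of [n]. *)
Definition spread (x : rseq R) : rseq R :=
  fun i => if n (k i) == i then x (k i) else 0.

Lemma spreadE x j : spread x (n j) = x j.
Proof. by rewrite /spread !nK eqxx. Qed.

Lemma assignment_map (f : nat -> nat) s : assignment s ->
  {in [seq q.2 | q <- s] &, injective f} -> assignment [seq (q.1, f q.2) | q <- s].
Proof.
move=> /andP[u1 u2] fi; rewrite /assignment -!map_comp/= u1/=.
by rewrite (map_comp f (fun q => q.2)) map_inj_in_uniq.
Qed.

Lemma asum_map (f : nat -> nat) s (x y : rseq R) :
  {in s, forall q, `|x (f q.2)| = `|y q.2|} ->
  asum [seq (q.1, f q.2) | q <- s] x = asum s y.
Proof.
move=> h; rewrite /asum big_map big_seq [RHS]big_seq; apply: eq_bigr => q qs /=.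
by rewrite h.
Qed.

Lemma asum_supported s (y : rseq R) : (forall i, n (k i) != i -> y i = 0) ->
  asum s y = asum [seq q <- s | n (k q.2) == q.2] y.
Proof.
move=> h; rewrite /asum big_filter [LHS](bigID (fun q => n (k q.2) == q.2))/=.
rewrite [X in _ + X]big1 ?addr0// => q /h ->.
by rewrite normr0 powR0 ?mulr0// gt_eqF ?p_gt0.
Qed.

Lemma k_inj_in (s : seq (nat * nat)) :
  {in [seq q.2 | q <- [seq q <- s | n (k q.2) == q.2]] &, injective k}.
Proof.
move=> i j /mapP[q]; rewrite mem_filter => /andP[/eqP hq _] ->.
move=> /mapP[q']; rewrite mem_filter => /andP[/eqP hq' _] -> kk.
by rewrite -hq kk hq'.
Qed.

Lemma assignment_spread s : assignment s -> assignment [seq (q.1, n q.2) | q <- s].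
Proof. by move=> vs; apply: (assignment_map n) => // i j _ _ /(can_inj nK). Qed.

(** Assignments travel both ways with equal sums: forward along [n], and back along [k] after
    discarding pairs whose coordinate is outside the range of [n]. *)
Lemma spread_normp x : in_dwp w p x ->
  in_dwp w p (spread x) /\ normp (spread x) = normp x.
Proof.
move=> xd.
have y0 i : n (k i) != i -> spread x i = 0 by rewrite /spread => /negbTE ->.
have yc : vanishing (spread x).
  have [/cvgr0_eventually xc _] := xd; apply/cvgr0_eventually => e e0.
  have [M hM] := xc e e0; exists (\max_(j <- iota 0 M) n j).+1 => i hi.
  rewrite /spread; case: eqP => [nki|_]; last by rewrite normr0 ltW.
  apply: hM; rewrite leqNgt; apply/negP => kM.
  have := leq_max_mem _ n (iota 0 M) (k i).
  by rewrite mem_iota add0n/= kM nki => /(_ isT); rewrite leqNgt hi.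
have [sd sle] : in_dwp w p (spread x) /\ normp (spread x) <= normp x.
  apply: normp_le => // s vs; rewrite (asum_supported _ _ y0).
  rewrite -(asum_map k _ x); last first.
    by move=> q; rewrite mem_filter /spread => /andP[-> _].
  apply: (asum_le_normp _ _ xd); apply: assignment_map; last exact: k_inj_in.
  exact: assignment_filter.
split; first exact: sd.
apply: le_anti; apply/andP; split; first exact: sle.
have xc : vanishing x by case: xd.
suff h : forall s, assignment s -> asum s x <= normp (spread x).
  exact: (normp_le x _ xc h).2.
move=> s vs.
rewrite -(asum_map n _ (spread x)); last by move=> q _; rewrite spreadE.
exact: asum_le_normp _ _ sd (assignment_spread s vs).
Qed.

(** This is the closed span of the e_(n_j), described by vanishing coordinates so that closedness
    follows from continuity of the coordinates. *)
Definition supported (z : rseq R) :=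
  in_dwp w p z /\ forall i, n (k i) != i -> z i = 0.

Lemma supported_spread z : supported z ->
  in_dwp w p (z \o n) /\ spread (z \o n) = z.
Proof.
move=> [zd z0]; split; last first.
  apply/funext => i; rewrite /spread /=; case: eqP => [->//|/eqP/z0 ->//].
have zc : vanishing (z \o n).
  have [/cvgr0_eventually xc _] := zd; apply/cvgr0_eventually => e e0.
  have [M hM] := xc e e0; exists (\max_(j <- iota 0 M) k j).+1 => i hi.
  apply: hM; rewrite leqNgt; apply/negP => nM.
  have := leq_max_mem _ k (iota 0 M) (n i).
  by rewrite mem_iota add0n/= nM nK => /(_ isT); rewrite leqNgt hi.
have [] // := normp_le (z \o n) (normp z) zc _ => s vs.
rewrite -(asum_map n _ z).
  exact: asum_le_normp _ _ zd (assignment_spread s vs).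
by [].
Qed.

Lemma supported_closed : closed_subspace w p supported.
Proof.
split=> [z []//| |a x y [xd x0] [yd y0]|z y hz yd yc].
- by split=> //; case: normp0.
- split=> [|i ni]; first by have [] := normp_lincomb a _ _ xd yd.
  by rewrite /lincomb x0// y0// mulr0 addr0.
- split=> // i ni; apply/eqP; rewrite -normr_eq0 eq_le normr_ge0 andbT.
  apply/ler_addgt0Pl => e e0; rewrite addr0.
  move/cvgr0_eventually: yc => /(_ e e0)[M /(_ M (leqnn _))].
  rewrite ger0_norm ?dwp_norm_ge0// => /le_trans hM.
  have [zd z0] := hz M; have [ld _] := normp_lincomb (-1) _ _ yd zd.
  apply: le_trans (hM _ (lexx _)).
  by have := coord_le_norm _ i ld; rewrite /lincomb z0// mulN1r addr0 normrN.
Qed.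

Lemma supported_iso : iso_to_dwp w p supported.
Proof.
exists spread; split=> [a x y _ _|x xd|z hz|].
- apply/funext => i; rewrite /spread /lincomb; case: ifP => // _.
  by rewrite mulr0 addr0.
- have [sd _] := spread_normp _ xd; split=> // i /negbTE ni.
  by rewrite /spread ni.
- by have [? ?] := supported_spread _ hz; exists (z \o n).
- exists 1, 1; split=> // x xd; have [_ sx] := spread_normp _ xd.
    rewrite !dwp_normE sx !mul1r; split; exact: lexx.
Qed.

End Spread.
(** * Fixing a copy of the space *)

Lemma powRp_le_id a : 0 <= a <= 1 -> a `^ p <= a.
Proof.
move=> /andP[a0 a1]; have [->|an0] := eqVneq a 0.
  by rewrite powR0// gt_eqF ?p_gt0.
have ap : 0 < a by rewrite lt_neqAle eq_sym an0.
rewrite -[leRHS]powRr1//; apply: ger_powR => //.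
by rewrite ap.
Qed.

(** If all coordinates of T e_n were at most [t], then T e_n would be its own minorant in
    [small_minorants], hence small. The peak lies beyond [M] because the first [M] coordinates of T
    e_n tend to 0. *)
Lemma peaks T e : bounded_op w p T -> 0 < e ->
  (forall M, exists2 n, (M <= n)%N & e < normp (T (unitv R n))) ->
  exists2 t, 0 < t & forall M, exists n m,
    [/\ (M <= n)%N, (M <= m)%N & t < `|T (unitv R n) m|].
Proof.
move=> bT e0 hex; have [t [N [t0 hN]]] := small_minorants _ _ bT e0.
exists t => // M; have [N' hN'] := coords_image_vanishing _ M bT _ t0.
have [n] := hex (maxn M (maxn N N')).
rewrite !geq_max => /and3P[Mn Nn N'n] en.
have [m tm] : exists m, t < `|T (unitv R n) m|.
  apply: contrapT => h; move: en; rewrite ltNge => /negP; apply.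
  apply: (hN n) => // m; rewrite leNgt; apply/negP => tm; by apply: h; exists m.
exists n, m; split=> //; rewrite leqNgt; apply/negP => mM.
by move: tm; rewrite ltNge (hN' n N'n m mM).
Qed.

(** Pairs are chosen recursively. Against finitely many earlier pairs, a far enough new one meets
    both smallness conditions: T e_n tends to 0 at each earlier coordinate, and each earlier image
    is a null sequence. *)
Lemma gliding_hump T t (d : nat -> R) : bounded_op w p T ->
  (forall k, 0 < d k) ->
  (forall M, exists n m, [/\ (M <= n)%N, (M <= m)%N & t < `|T (unitv R n) m|]) ->
  exists n m : nat -> nat, [/\ {homo n : i j / (i < j)%N}, {homo m : i j / (i < j)%N},
    forall k, t < `|T (unitv R (n k)) (m k)| &
    forall j k, (j < k)%N -> `|T (unitv R (n k)) (m j)| <= d k /\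
                             `|T (unitv R (n j)) (m k)| <= d k].
Proof.
move=> bT d0 ht; have [_ Td _] := bT.
pose good (l : seq (nat * nat)) e (q : nat * nat) := forall r, r \in l ->
  [/\ (r.1 < q.1)%N, (r.2 < q.2)%N, `|T (unitv R q.1) r.2| <= e &
      `|T (unitv R r.1) q.2| <= e].
have far l e : 0 < e -> exists M, forall q, (M <= q.1)%N -> (M <= q.2)%N -> good l e q.
  move=> e0; elim: l => [|r l [M hM]]; first by exists 0%N.
  have [M1 hM1] := coord_image_vanishing _ r.2 bT _ e0.
  have [M2 hM2] : exists M2, forall i, (M2 <= i)%N -> `|T (unitv R r.1) i| <= e.
    by have [/cvgr0_eventually h _] := Td _ (in_dwp_unitv r.1); exact: h.
  exists (maxn (maxn M (maxn M1 M2)) (maxn r.1 r.2).+1) => q.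
  rewrite !(geq_max, gtn_max) => /andP[/and3P[Mq M1q M2q] /andP[r1q r2q]].
  move=> /andP[/and3P[Mq' M1q' M2q'] /andP[r1q' r2q']] r'.
  rewrite inE => /predU1P[->|r'l]; last exact: hM.
  by split=> //; [exact: hM1|exact: hM2].
have step l : exists q, t < `|T (unitv R q.1) q.2| /\ good l (d (size l)) q.
  have [M hM] := far l _ (d0 (size l)); have [n [m [Mn Mm tm]]] := ht M.
  by exists (n, m); split=> //; exact: hM.
have [F hF] := choice step.
(* [L k] holds the first [k] pairs, latest first; its length [k] selects the tolerance [d k]. *)
pose L := fix L k := if k is k'.+1 then F (L k') :: L k' else [::].
have sL k : size (L k) = k by elim: k => //= k ->.
have inL j k : (j < k)%N -> F (L j) \in L k.
  elim: k => // k IH; rewrite ltnS leq_eqVlt inE => /predU1P[->|/IH ->].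
    by rewrite eqxx.
  by rewrite orbT.
have Fgood j k : (j < k)%N -> _ := fun jk => (hF (L k)).2 _ (inL _ _ jk).
exists (fun k => (F (L k)).1), (fun k => (F (L k)).2); split.
- by move=> j k jk; have [] := Fgood j k jk.
- by move=> j k jk; have [] := Fgood j k jk.
- by move=> k; have [] := hF (L k).
- by move=> j k jk; have [_ _] := Fgood j k jk; rewrite sL.
Qed.

(** * Lower bound for an almost diagonal matrix *)

Section HumpBound.
Context (T : rseq R -> rseq R) (t : R) (n m k : nat -> nat).
Hypotheses (bT : bounded_op w p T) (t0 : 0 < t) (nK : cancel n k)
  (m_inj : injective m)
  (diag : forall j, t < `|T (unitv R (n j)) (m j)|)
  (offdiag : forall i j, i != j ->
    `|T (unitv R (n i)) (m j)| <= t / 16 * (2^-1 ^+ i * 2^-1 ^+ j)).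

Let h (j : nat) : R := 2^-1 ^+ j.
Let h_ge0 j : 0 <= h j. Proof. by rewrite exprn_ge0// invr_ge0. Qed.

Lemma sum_supported_geo M : \sum_(i <- iota 0 M | n (k i) == i) h (k i) <= 2.
Proof.
rewrite -big_filter -(big_map k xpredT h); apply: sum_geo_uniq.
rewrite map_inj_in_uniq ?filter_uniq ?iota_uniq// => i j.
by rewrite !mem_filter => /andP[/eqP <- _] /andP[/eqP <- _]; rewrite !nK => ->.
Qed.

(** Coordinate [m j] of [T z] is the diagonal term plus a remainder. As each entry of [z] is at most
    its norm, the remainder is bounded by a geometric series of sum at most 2, turning t/16 into
    t/8. *)
Lemma hump_coord z j : supported n k z ->
  t * `|z (n j)| <= `|T z (m j)| + dwp_norm w p z * (t / 8) * h j.
Proof.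
move=> [zd z0]; apply/ler_addgt0Pl => e e0.
have [M hM] := coord_expansion _ _ (m j) _ bT zd e0.
pose X := dwp_norm w p z.
have X0 : 0 <= X := dwp_norm_ge0 z.
have t160 : 0 <= t / 16 by rewrite divr_ge0// ltW.
have := hM _ (leq_maxl M (n j).+1); set M' := maxn _ _.
have njM : n j \in iota 0 M' by rewrite mem_iota add0n/= leq_maxr.
rewrite -(big_mkord xpredT (fun i => z i * T (unitv R i) (m j))).
rewrite /index_iota subn0 (bigD1_seq (n j))//= ?iota_uniq//.
set rest := \sum_(i <- _ | _) _ => hrest.
have restX : `|rest| <= X * (t / 8) * h j.
  apply: le_trans (ler_norm_sum _ _ _) _.
  apply: (@le_trans _ _ (\sum_(i <- iota 0 M' | n (k i) == i)
      X * (t / 16) * h j * h (k i))).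
    rewrite big_mkcond [leRHS]big_mkcond; apply: ler_sum => i _ /=.
    have b0 : 0 <= X * (t / 16) * h j * h (k i).
      exact: mulr_ge0 (mulr_ge0 (mulr_ge0 X0 t160) (h_ge0 _)) (h_ge0 _).
    case: (eqVneq i (n j)) => [_|inj]/=; first by case: ifP.
    case: eqP => [ki|/eqP/z0 ->]; last by rewrite mul0r normr0.
    rewrite normrM -!mulrA ler_pM//; first exact: coord_le_norm.
    rewrite (mulrC (h j)); have := offdiag (k i) j; rewrite ki -!mulrA; apply.
    by apply: contraNneq inj => <-; rewrite ki.
  rewrite -mulr_sumr.
  apply: (@le_trans _ _ (X * (t / 16) * h j * 2)).
    apply: ler_wpM2l (sum_supported_geo _).
    exact: mulr_ge0 (mulr_ge0 X0 t160) (h_ge0 _).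
  by rewrite le_eqVlt; apply/orP; left; apply/eqP; field.
have tz : t * `|z (n j)| <= `|z (n j) * T (unitv R (n j)) (m j)|.
  by rewrite normrM mulrC ler_wpM2l// ltW.
apply: (le_trans tz).
(* Used with [a] the diagonal term, [b] the coordinate of [T z] and [c] the remainder. *)
have tri (a b c : R) : `|a| <= `|b| + `|b - (a + c)| + `|c|.
  rewrite {1}(_ : a = b - (b - (a + c)) - c); last by ring.
  by apply: le_trans (ler_normB _ _) _; rewrite lerD2r; exact: ler_normB.
apply: le_trans (tri _ (T z (m j)) rest) _.
move: hrest restX; rewrite -/X; set a := `|_ - _|; set b := `|rest|; lra.
Qed.

Lemma hump_normp z : supported n k z ->
  normp z <= 2 * 2 `^ p / t `^ p * normp (T z).
Proof.
move=> zs; have [zd z0] := zs; have [_ Td _] := bT.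
have tp : 0 < t `^ p by exact: powR_gt0.
pose X := dwp_norm w p z.
have X0 : 0 <= X := dwp_norm_ge0 z.
(* The second term is the off-diagonal error. It is half of the quantity being bounded, so it moves
   to the left, which produces the factor 2 in the constant. *)
pose B := 2 `^ p * normp (T z) + t `^ p / 2 * normp z.
suff key s : assignment s -> t `^ p * asum s z <= B.
  have zc : vanishing z by case: zd.
  have hs s : assignment s -> asum s z <= B / t `^ p.
    by move=> /key hB; rewrite ler_pdivlMr// mulrC.
  have := (normp_le z _ zc hs).2; rewrite ler_pdivlMr// /B => hz.
  rewrite mulrAC (ler_pdivlMr _ _ tp); move: hz.
  move: (normp z) (normp (T z)) (2 `^ p) (t `^ p) => a b c d; lra.
move=> vs; rewrite (asum_supported n k _ _ z0).
set s' := [seq q <- s | _].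
have vs' : assignment s' by exact: assignment_filter.
rewrite -{1}(gtr0_norm t0) -asumZ.
pose y : rseq R := fun i => T z (m (k i)).
pose g : rseq R := fun i => X * (t / 8) * h (k i).
have t80 : 0 <= t / 8 by rewrite divr_ge0// ltW.
have g0 i : 0 <= g i := mulr_ge0 (mulr_ge0 X0 t80) (h_ge0 _).
have dom i : `|t * z i| <= `|y i| + `|g i|.
  rewrite normrM (gtr0_norm t0) (ger0_norm (g0 i)).
  case: (eqVneq (n (k i)) i) => [ki|/z0 ->]; last by rewrite normr0 mulr0 addr_ge0.
  by have := hump_coord z (k i) zs; rewrite ki.
apply: le_trans (asum_dom2 _ _ _ _ dom) _.
have ky : asum s' y <= normp (T z).
  rewrite -(asum_map (m \o k) s' (T z) y)//.
  apply: (asum_le_normp _ _ (Td _ zd)); apply: assignment_map => // i j is' js'.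
  by move/m_inj; exact: (k_inj_in n k s).
(* With X^p equal to [normp z], the error is at most 2 X^p (t/8)^p. After the factor 2^p it is 2 X^p
   (t/4)^p, at most X^p t^p / 2 since 4^(-p) <= 1/4. *)
have kg : asum s' g <= t `^ p / 2 * normp z / 2 `^ p.
  apply: (@le_trans _ _ ((X * (t / 8)) `^ p * \sum_(q <- s') h (k q.2))).
    rewrite mulr_sumr; apply: ler_sum => q _.
    rewrite (ger0_norm (g0 _)) /g (powRM _ (mulr_ge0 X0 t80) (h_ge0 _)).
    rewrite -[leRHS]mul1r ler_pM ?weight_ge0 ?weight_le1 ?mulr_ge0 ?powR_ge0//.
    rewrite ler_wpM2l ?powR_ge0//; apply: powRp_le_id; rewrite h_ge0/=.
    by rewrite exprn_ile1// ?invr_ge0// invf_le1 ?ler1n.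
  have geo : \sum_(q <- s') h (k q.2) <= 2.
    rewrite -(big_map (fun q => k q.2) xpredT h); apply: sum_geo_uniq.
    rewrite (map_comp k (fun q => q.2)) map_inj_in_uniq; last exact: (k_inj_in n k s).
    by case/andP: vs'.
  have p2 : 0 < 2 `^ p :> R by exact: powR_gt0.
  rewrite (ler_pdivlMr _ _ p2) powRM// (_ : X `^ p = normp z); last exact: dwp_normK.
  apply: (@le_trans _ _ (normp z * (t / 8) `^ p * 2 * 2 `^ p)).
    apply: (ler_wpM2r (ltW p2)); apply: (ler_wpM2l _ geo).
    exact: mulr_ge0 (normp_ge0 _ zd) (powR_ge0 _ _).
  have -> : normp z * (t / 8) `^ p * 2 * 2 `^ p =
      normp z * 2 * ((t / 8) `^ p * 2 `^ p) by ring.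
  rewrite -powRM// (_ : t / 8 * 2 = t * 4^-1); last by field.
  have i4 : 0 <= 4^-1 :> R by rewrite invr_ge0.
  rewrite (powRM _ (ltW t0) i4).
  have q4 : (4^-1 : R) `^ p <= 4^-1.
    by apply: powRp_le_id; rewrite i4 invf_le1 ?ler1n.
  have zt : 0 <= normp z * 2 * t `^ p.
    exact: mulr_ge0 (mulr_ge0 (normp_ge0 _ zd) (ler0n _ _)) (ltW tp).
  rewrite mulrA; apply: (le_trans (ler_wpM2l zt q4)).
  by rewrite le_eqVlt; apply/orP; left; apply/eqP; field.
rewrite mulrDr /B; apply: lerD; first exact: (ler_wpM2l (powR_ge0 _ _) ky).
by rewrite mulrC -ler_pdivlMr ?powR_gt0.
Qed.

Lemma hump_iso_on : iso_on w p T (supported n k).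
Proof.
have [_ Td _] := bT.
pose C := (2 * 2 `^ p / t `^ p) `^ p^-1.
have C0 : 0 < C by rewrite powR_gt0// divr_gt0 ?mulr_gt0 ?powR_gt0.
exists C^-1; split; first by rewrite invr_gt0.
move=> z zs; have [zd _] := zs; rewrite mulrC ler_pdivrMr// mulrC.
apply: (norm_le_of_normp _ _ _ zd (Td _ zd) (ltW C0)).
rewrite powRpK; first exact: hump_normp.
by rewrite divr_ge0 ?mulr_ge0 ?powR_ge0.
Qed.

End HumpBound.

Lemma image_cvg0_of_singular T : bounded_op w p T -> dwp_strictly_singular w p T ->
  forall e, 0 < e -> exists M, forall n, (M <= n)%N -> normp (T (unitv R n)) <= e.
Proof.
move=> bT sT e e0; apply: contrapT => nh.
have hex M : exists2 n, (M <= n)%N & e < normp (T (unitv R n)).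
  apply: contrapT => H; apply: nh; exists M => n Mn.
  by rewrite leNgt; apply/negP => en; apply: H; exists n.
have [t t0 ht] := peaks _ _ bT e0 hex.
(* [d k] depends on the later index only; as 2^(-k) <= 2^(-j) for j < k, it gives the product bound
   of [hump_iso_on] on both sides of the diagonal. *)
pose d k := t / 16 * (2^-1 ^+ k * 2^-1 ^+ k).
have d0 k : 0 < d k by rewrite mulr_gt0 ?divr_gt0// mulr_gt0 ?exprn_gt0 ?invr_gt0.
have [n [m [nm mm diag off]]] := gliding_hump _ _ d bT d0 ht.
have inj (f : nat -> nat) : {homo f : i j / (i < j)%N} -> injective f.
  move=> fm i j fij; case: (ltngtP i j) => // ij.
    by have := fm _ _ ij; rewrite fij ltnn.
  by have := fm _ _ ij; rewrite fij ltnn.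
have n_inj := inj _ nm; have m_inj := inj _ mm.
(* A left inverse of [n], with the arbitrary value 0 outside its range. *)
have /choice[k hk] : forall i, exists j, (exists j', n j' = i) -> n j = i.
  move=> i; have [[j nj]|nj] := pselect (exists j, n j = i); first by exists j.
  by exists 0%N => /nj.
have nK : cancel n k by move=> j; apply/n_inj/hk; exists j.
have h01 i : 0 <= 2^-1 ^+ i :> R by rewrite exprn_ge0 ?invr_ge0.
have hanti i j : (i < j)%N -> 2^-1 ^+ j <= 2^-1 ^+ i :> R.
  by move=> ij; apply: ler_wiXn2l; rewrite ?invr_ge0 ?invf_le1 ?ler1n// ltnW.
have t160 : 0 <= t / 16 by rewrite divr_ge0// ltW.
apply: (sT (supported n k) (supported_closed n k) (supported_iso n k nK)).
apply: (hump_iso_on T t n m k bT t0 nK m_inj diag) => i j.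
rewrite neq_ltn => /orP[ij|ji].
  apply: le_trans (off _ _ ij).2 _.
  by rewrite /d ler_wpM2l// ler_wpM2r// hanti.
apply: le_trans (off _ _ ji).1 _.
by rewrite /d ler_wpM2l// ler_wpM2l// hanti.
Qed.

End Lorentz.

Theorem theorem5p5 (R : realType) (p : R) (w : rseq R)
  (hp : 1 <= p) (hw : lorentz_weight w) (T : rseq R -> rseq R)
  (hT : bounded_op w p T) :
  dwp_strictly_singular w p T <->
  (fun n => dwp_norm w p (T (unitv R n))) @ \oo --> (0 : R).
Proof.
have [_ Td _] := hT.
have Ted n : in_dwp w p (T (unitv R n)) := Td _ (in_dwp_unitv R p w hp hw n).
split=> [sT|Te].
  apply/(dwp_norm_cvg0 R p w hp hw _ Ted).
  exact: image_cvg0_of_singular.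
apply: singular_of_image_cvg0 => //.
exact/(dwp_norm_cvg0 R p w hp hw _ Ted).
Qed.
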